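(* Let $K$ be a Cantor set, let $T:K\to K$ be a homeomorphism, and let $K_1,\dots,K_N$ be pairwise disjoint Cantor sets with $K=\bigcup_{i=1}^N K_i$. Then there exists a homeomorphism $\widetilde T:K\to K$ such that for every $x\in K$ and every $1\le i\le N$, $\widetilde T(x)\in K_i$ if and only if $T(x)\in K_i$, and for every $x\in K$ the $\omega$-limit set of $x$ under $\widetilde T$ is a periodic orbit.
   Context: A Cantor set is a nonempty totally disconnected, perfect, compact metric space. *)

(* Defs.v *)
From HB Require Import structures.
From mathcomp Require Import all_boot all_order all_algebra.
From mathcomp Require Import all_classical all_reals all_analysis.
Set Implicit Arguments. Unset Strict Implicit. Unset Printing Implicit Defensive.
Import Order.TTheory GRing.Theory Num.Theory.
Local Open Scope classical_set_scope.

Definition is_cantor_set {T : topologicalType} (A : set T) : Prop :=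
  [/\ A !=set0, compact A, perfect_set A & totally_disconnected A].

Definition homeomorphism {T : topologicalType} (f : T -> T) : Prop :=
  exists g : T -> T, [/\ cancel f g, cancel g f, continuous f & continuous g].

Definition omega_limit {T : topologicalType} (f : T -> T) (x : T) : set T :=
  [set y | forall U, nbhs y U -> forall m : nat, exists2 n : nat, (m <= n)%N & U (iter n f x)].

Definition periodic_orbit {T : topologicalType} (f : T -> T) (S : set T) : Prop :=
  exists p : T, exists2 k : nat, (0 < k)%N & iter k f p = p /\ S = range (fun n => iter n f p).

(* Main.v *)
Require Import Defs.
From HB Require Import structures.
From mathcomp Require Import all_boot all_order all_algebra.
From mathcomp Require Import all_classical all_reals all_analysis zify.
Set Implicit Arguments. Unset Strict Implicit. Unset Printing Implicit Defensive.
Import Order.TTheory GRing.Theory Num.Theory.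
Local Open Scope classical_set_scope.

(** The itineraries of [T] through the partition define a finite directed graph:
there is an edge from [i] to [j] when [T] maps some point of [K_i] into [K_j].
Every vertex has an outgoing and an incoming edge, so we may choose a successor
[s] and a predecessor [p] of each vertex. Consider the bi-infinite walks which
follow [p] backwards up to some edge and follow [s] forwards after it, together
with their limits. They form a closed shift-invariant set, each edge is crossed
at time [0] by one of them, and each of them is eventually periodic in the
future because [s] and [p] act on a finite set. The product of this subshift
with the Cantor space, on which the shift acts trivially in the second factor,
is a model system. For each edge [(i, j)], the part of [K_i] sent by [T] into
[K_j] and the part of the model whose walks cross [(i, j)] at time [0] are both
Cantor sets, hence homeomorphic; gluing these homeomorphisms over the finitely
many edges conjugates the model to the desired homeomorphism of [K]. *)

(** * Zero-dimensionality of totally disconnected compact spaces *)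

Lemma zero_dimensional_hausdorff (T : topologicalType) :
  zero_dimensional T -> hausdorff_space T.
Proof.
move=> zdT p q pq; apply: contrapT => /eqP /zdT[U [[oU cU] Up nUq]].
have [z []//] := pq U (~` U) (open_nbhs_nbhs (conj oU Up))
  (open_nbhs_nbhs (conj (closed_openC cU) nUq)).
Qed.

Definition quasi_component (T : topologicalType) (x : T) : set T :=
  \bigcap_(D in [set D | clopen D /\ D x]) D.

Section quasi_component.
Context (T : topologicalType) (x : T).
Let Q := quasi_component x.

Lemma quasi_component_refl : Q x. Proof. by move=> D []. Qed.

Lemma closed_quasi_component : closed Q.
Proof. by apply: closed_bigI => D [[]]. Qed.

(** By compactness: otherwise the sets [D] minus [O], for [D] clopen around [x], form a filter base
    whose cluster point lies in [Q] but outside [O]. *)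
Lemma quasi_component_sub_open (O : set T) : compact [set: T] ->
  open O -> Q `<=` O -> exists D, [/\ clopen D, D x & D `<=` O].
Proof.
move=> cT oO QO; apply: contrapT => nD.
pose F := filter_from [set D : set T | clopen D /\ D x] (fun D => D `&` ~` O).
have FF : ProperFilter F.
  apply: filter_from_proper.
    apply: filter_from_filter; first by exists setT; split => //; exact: clopenT.
    move=> A B [? ?] [? ?]; exists (A `&` B); first by split=> //; exact: clopenI.
    by move=> z [[? ?] ?].
  move=> D [clD Dx]; apply: contrapT => D0; apply: nD; exists D; split => // z Dz.
  by apply: contrapT => nOz; apply: D0; exists z.
have [z [_ clz]] := cT F FF filterT.
have nOz : (~` O) z.
  have /closure_id -> : closed (~` O) by exact: open_closedC.
  rewrite closureEcluster => A B AO; apply: (clz A B); exists setT => //.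
    by split => //; exact: clopenT.
  by move=> u [_ nOu]; exact: AO.
apply: nOz; apply: QO => D [[oD cD] Dx].
rewrite (closure_id D).1// closureEcluster => A B AD.
by apply: (clz A B); exists D => // u [Du _]; exact: AD.
Qed.

(** By normality, a relatively clopen part of [Q] containing [x] is the trace on [Q] of a clopen set
    around [x], and such a set contains [Q]. *)
Lemma connected_quasi_component : hausdorff_space T -> compact [set: T] ->
  connected Q.
Proof.
move=> hT cT.
have key B C : B x -> closed B -> B `<=` Q -> open C -> B = Q `&` C -> B = Q.
  move=> Bx cB BQ oC BE.
  have nW : set_nbhs B (~` (Q `&` ~` C)).
    move=> b Bb; apply: open_nbhs_nbhs; split.
      by apply: closed_openC; apply: closedI;
        [exact: closed_quasi_component|exact: open_closedC].
    by move: Bb; rewrite BE => -[Qb Cb] [].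
  have [V nV VW] := compact_normal hT cT cB nW.
  pose U := interior V.
  have BU : B `<=` U by move=> b /nV.
  have UW : closure U `<=` ~` (Q `&` ~` C).
    by move=> z /(closureS (@interior_subset _ V)) /VW.
  have [||D [[oD cD] Dx DO]] :=
      @quasi_component_sub_open (U `|` ~` (closure U)) cT.
  - apply: openU; first exact: open_interior.
    exact/closed_openC/closed_closure.
  - move=> z Qz; have [Cz|nCz] := pselect (C z).
      by left; apply: BU; rewrite BE.
    by right => /UW; apply.
  (* [D] misses the boundary of the open set [U], so its intersection with [U] is clopen. *)
  - have DU : D `&` U = D `&` closure U.
      apply/seteqP; split=> z [Dz Uz]; split => //; first exact: subset_closure.
      by case: (DO _ Dz).
    apply/seteqP; split => // z Qz.
    have [_ Uz] : (D `&` U) z.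
      apply: Qz; split; last by split => //; exact: BU.
      split; first by apply: openI => //; exact: open_interior.
      by rewrite DU; apply: closedI => //; exact: closed_closure.
    rewrite BE; split => //; apply: contrapT => nCz.
    exact: (UW _ (subset_closure Uz)).
move=> B [b Bb] [C oC BC] [D cD BD].
have BQ : B `<=` Q by rewrite BC => z [].
have [Bx|nBx] := pselect (B x).
  apply: (key B C) => //.
  by rewrite BD; apply: closedI => //; exact: closed_quasi_component.
have QB : Q `&` ~` C = Q `&` ~` D.
  apply/seteqP; split => z [Qz nz]; split => // z'; apply: nz.
    by have : (Q `&` D) z by []; rewrite -BD BC => -[].
  by have : (Q `&` C) z by []; rewrite -BC BD => -[].
(* When [x] lies outside [B], [key] for the complement of [B] in [Q] would make [B] empty. *)
suff E : Q `&` ~` C = Q.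
  by have := BQ _ Bb; rewrite -{1}E => -[_]; have := Bb; rewrite BC => -[].
apply: (key _ (~` D)) => //.
- split; first exact: quasi_component_refl.
  by move=> Cx; apply: nBx; rewrite BC; split => //; exact: quasi_component_refl.
- by apply: closedI; [exact: closed_quasi_component|exact: open_closedC].
- exact: closed_openC.
Qed.

End quasi_component.

Lemma totally_disconnected_zero_dimensional (T : topologicalType) :
  hausdorff_space T -> compact [set: T] -> totally_disconnected [set: T] ->
  zero_dimensional T.
Proof.
move=> hT cT tdT x y xy; apply: contrapT => nD.
suff : connected_component [set: T] x y.
  by rewrite tdT// => yx; move: xy; rewrite yx eqxx.
exists (quasi_component x); last first.
  by move=> D [clD Dx]; apply: contrapT => nDy; apply: nD; exists D.
split => //; first exact: quasi_component_refl.
exact: connected_quasi_component.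
Qed.

(** * Cantor subsets *)

Section cantor_subset.
Context (X : topologicalType) (A : set X).

Lemma compact_set_type : compact A -> compact [set: A].
Proof.
move=> cA F FF _.
have [|p [Ap clp]] := cA (set_val @ F) _.
  by apply: (@filterS _ F _ setT); [move=> a _; exact: set_valP|exact: filterT].
exists (SigSub (mem_set Ap) : A); split => // B C FB [_ [[W oW <-] Wp WC]].
have [|z [[b Bb bz] Wz]] := clp (set_val @` B) W _ (open_nbhs_nbhs (conj oW Wp)).
  by apply: (@filterS _ F _ B) => // b Bb; exists b.
by exists b; split => //; apply: WC; rewrite /= bz.
Qed.

Lemma zero_dimensional_set_type : zero_dimensional X -> zero_dimensional A.
Proof.
move=> zX x y xy.
have /zX[U [clU Ux nUy]] : set_val x != set_val y.
  by apply: contra xy => /eqP/val_inj ->.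
exists (set_val @^-1` U); split => //; apply: preimage_clopen => //.
exact: initial_continuous.
Qed.

Lemma perfect_set_type : A `<=` limit_point A -> perfect_set [set: A].
Proof.
move=> lA; apply/perfectTP => x [W oW Wx].
have Wvx : W (set_val x) by have : [set x] x by []; rewrite -Wx.
have [y [yx Ay Wy]] := lA _ (set_valP x) _ (open_nbhs_nbhs (conj oW Wvx)).
have : (set_val @^-1` W) (SigSub (mem_set Ay) : A) by [].
by rewrite Wx => /(congr1 set_val) /= /eqP; rewrite (negbTE yx).
Qed.

End cantor_subset.

(** [g] is a homeomorphism of [C] onto [A] with inverse [f]; [f] is total on [X], but only its
    restriction to [A] matters. *)
Definition parametrizes (C X : topologicalType) (A : set X)
    (g : C -> X) (f : X -> C) :=
  [/\ continuous g, (forall c, A (g c)), cancel g f,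
      {in A, cancel f g} & {within A, continuous f}].

(** Brouwer's characterization of the Cantor space, applied to the subspace [A]; outside [A] the
    inverse takes the default value [point]. *)
Lemma cantor_subset_parametrization (R : realType) (X : pseudoMetricType R)
    (A : set X) : zero_dimensional X -> compact A -> A `<=` limit_point A ->
  A !=set0 -> exists g f, @parametrizes cantor_space X A g f.
Proof.
move=> zX cA lA [a Aa].
pose P := isPointed.Build A (SigSub (mem_set Aa)).
pose TA : pseudoPMetricType R := HB.pack A P.
have cTA : cantor_like TA.
  have zA : zero_dimensional TA by exact: zero_dimensional_set_type.
  split => //; first exact: perfect_set_type.
    exact: compact_set_type.
  exact: zero_dimensional_hausdorff.
have [h [ch clh]] := homeomorphism_cantor_like cTA.
have hK : cancel h h^-1%FUN by move=> c; apply: funK; exact: in_setT.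
have hVK : cancel h^-1%FUN h by move=> x; apply: invK; exact: in_setT.
have chV : continuous (h^-1%FUN : A -> cantor_space).
  apply/continuous_closedP => B cB.
  rewrite (_ : _ @^-1` B = h @` B); first exact: clh.
  apply/seteqP; split => [z Bz|_ [z Bz <-]]; first by exists (h^-1%FUN z).
  by rewrite /preimage/= hK.
have hV (b : A) : valL_ (point : cantor_space) h^-1%FUN (set_val b) = h^-1%FUN b.
  exact: (congr1 (@^~ b) (@valLK _ _ (point : cantor_space) A h^-1%FUN)).
exists (set_val \o h), (valL_ point h^-1%FUN); split.
- move=> c; apply: continuous_comp; first exact: ch.
  exact: initial_continuous.
- by move=> c; exact: set_valP.
- by move=> c; rewrite /comp hV hK.
- move=> x /set_mem Ax.
  by rewrite /comp (hV (SigSub (mem_set Ax))) hVK.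
- exact/subspace_valL_continuousP'.
Qed.

(** * Omega-limit sets *)

Lemma iter_continuous_at (X : topologicalType) (f : X -> X) r (p : X) : continuous f ->
  {for p, continuous (iter r f)}.
Proof.
move=> cf; elim: r p => [|r IH] p; first exact: cvg_id.
by apply: (continuous_comp (IH p)); exact: cf.
Qed.

(** Along each residue class of times modulo [k] the orbit converges to a point of the orbit of [p].
    Any other point is separated from these finitely many limits, hence from the tail of the
    orbit. *)
Lemma omega_limit_periodic (X : topologicalType) (f : X -> X) x p k :
  hausdorff_space X -> continuous f -> (0 < k)%N -> iter k f p = p ->
  (fun n => iter (n * k) f x) @ \oo --> p -> periodic_orbit f (omega_limit f x).
Proof.
move=> hX cf k0 fkp xp; exists p, k => //; split => //.
have cvr r : (fun n => iter (r + n * k) f x) @ \oo --> iter r f p.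
  under eq_fun do rewrite iterD.
  apply: (@cvg_comp _ _ _ (fun n => iter (n * k) f x) (iter r f) _ _ _ xp).
  exact: iter_continuous_at.
apply/seteqP; split => [y yo|_ [r _ <-] U Ur m]; last first.
  have [n _ nU] := cvr r U Ur.
  exists (r + (n + m) * k)%N; last by apply: nU; rewrite /= leq_addr.
  apply: leq_trans (leq_addl _ _); apply: leq_trans (leq_addl n _) _.
  by rewrite leq_pmulr.
apply: contrapT => ny.
have sep (r : 'I_k) : exists UV : set X * set X,
    [/\ nbhs y UV.1, nbhs (iter r f p) UV.2 & UV.1 `&` UV.2 = set0].
  have : y != iter r f p by apply/eqP => yr; apply: ny; exists r.
  move: hX; rewrite open_hausdorff => /[apply] -[[U V]/= [/set_mem yU /set_mem rV]].
  move=> [oU oV /eqP UV0]; exists (U, V).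
  by split => //=; apply: open_nbhs_nbhs.
have [UV UVP] := choice sep.
have nU : nbhs y (fun z => forall r, (UV r).1 z).
  by apply: filter_forall => r; have [] := UVP r.
have [M _ MV] : \forall n \near \oo, forall r : 'I_k, (UV r).2 (iter (r + n * k) f x).
  by apply: filter_forall => r; have [_ + _] := UVP r; exact: cvr.
(* From time [M * k] on, the quotient of the time by [k] is at least [M]. *)
have [n Mn Un] := yo _ nU (M * k)%N.
pose r := Ordinal (ltn_pmod n k0).
have [_ _] := UVP r; apply/eqP/set0P; exists (iter n f x); split => //.
rewrite [X in iter X](divn_eq n k) addnC; apply: (MV (n %/ k)%N) => /=.
by rewrite leq_divRL.
Qed.

(** * The subshift of walks *)

(** The space of the two-sided full shift over the alphabet [V]. *)
Definition biseq (V : finType) : Type :=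
  prod_topology (fun _ : int => discrete_topology V).

HB.instance Definition _ (V : finType) := Uniform.on (biseq V).
HB.instance Definition _ (R : realType) (V : finType) : @PseudoMetric R _ :=
  @PseudoMetric.on (biseq V).

(* Without this instance, resolution tries [prod_topology_filter], which wants
   the alphabet to be pointed, and diverges. *)
Global Instance biseq_nbhs_filter (V : finType) (x : biseq V) :
  ProperFilter (nbhs x) | 0 := nbhs_pfilter x.

Section walks.
Context (V : finType).
Local Notation W := (biseq V).

Lemma near_coord (x : W) (j : int) : \forall y \near x, y j = x j.
Proof.
have := @proj_continuous int (fun=> discrete_topology V) j x [set x j].
by apply; exact: discrete_set1.
Qed.

Lemma cvg_coord (F : set_system W) (x : W) : Filter F ->
  (forall j, \forall y \near F, y j = x j) -> F --> x.
Proof.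
move=> FF Fx; apply/cvg_sup => j U [B [[C oC <-] Cx BU]].
by apply: filterS (Fx j) => y yj; apply: BU; rewrite /= yj.
Qed.

Definition biseq_shift (n : int) (x : W) : W := fun j => x (j + n)%R.

Lemma biseq_shift_continuous n : continuous (biseq_shift n).
Proof.
move=> x; apply: cvg_coord => j; exact: (near_coord x (j + n)%R).
Qed.

Lemma compact_biseq : compact [set: W].
Proof.
have cV (_ : int) : compact [set: discrete_topology V].
  by apply: finite_compact; exact: finite_finset.
have := tychonoff cV; congr (compact _).
by apply/seteqP; split.
Qed.

Lemma zero_dimensional_biseq : zero_dimensional W.
Proof. by apply: zero_dimension_prod => _; exact: discrete_zero_dimension. Qed.

Context (E : V -> V -> Prop) (s p : V -> V).

(* At most one step [i -> i + 1] of the walk is free: before it the walk is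
   dictated backwards by [p], after it forwards by [s]. Stated over pairs
   [i < j], so that the condition is closed and also holds for the limits in
   which the free step has escaped to infinity. *)
Definition walks : set W := [set x | (forall k, E (x k) (x (k + 1)%R)) /\
  (forall i j, (i < j)%R -> x (i - 1)%R = p (x i) \/ x (j + 1)%R = s (x j))].

(** Each instance of the conditions involves finitely many coordinates, on which a point of the
    closure agrees with some walk. *)
Lemma closed_walks : closed walks.
Proof.
move=> x xcl; split => [k|i j ij].
  have [y [[Ey _] [yk yk1]]] := xcl _ (filterI (near_coord x k) (near_coord x (k + 1)%R)).
  by rewrite -yk -yk1.
have [y [[_ yP] [[y1 y2] [y3 y4]]]] := xcl _
  (filterI (filterI (near_coord x i) (near_coord x (i - 1)%R))
           (filterI (near_coord x j) (near_coord x (j + 1)%R))).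
by rewrite -y1 -y2 -y3 -y4; exact: yP.
Qed.

Lemma shift_walks n x : walks x -> walks (biseq_shift n x).
Proof.
move=> [xE xP]; split=> [k|i j ij]; rewrite /biseq_shift.
  by rewrite addrAC; exact: xE.
by rewrite !(addrAC _ _ n); apply: xP; rewrite ltrD2r.
Qed.

Lemma walks_through_edge i j : (forall v, E v (s v)) -> (forall v, E (p v) v) ->
  E i j -> exists2 x, walks x & x 0%R = i /\ x 1%R = j.
Proof.
move=> Es Ep Eij.
(* The free step goes from position [0] to [1]; [Negz n] is the position [-(n + 1)]. *)
pose x (k : int) : V :=
  match k with Posz n.+1 => iter n s j | Posz 0 => i | Negz n => iter n.+1 p i end.
have xp k : (k <= 0)%R -> x (k - 1)%R = p (x k).
  case: k => [[|n]|n] // _.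
  by have -> : (Negz n - 1)%R = Negz n.+1 by lia.
have xs k : (0 < k)%R -> x (k + 1)%R = s (x k).
  case: k => [[|n]|n] // _.
  by have -> : (Posz n.+1 + 1)%R = Posz n.+2 by lia.
exists x => //; split=> [k|a b ab].
  have [k0|k0] := ltrP 0%R k; first by rewrite xs.
  move: k0; rewrite le_eqVlt => /predU1P[->//|k0].
  have := @xp (k + 1)%R; rewrite addrK => -> //.
  by rewrite -ltzD1 ltrD2r.
have [a0|a0] := lerP a 0%R; first by left; exact: xp.
by right; apply: xs; exact: lt_trans ab.
Qed.

(** Pigeonhole on the finite set of self-maps of [V], so that one preperiod and one period serve all
    [v]. *)
Lemma iter_eventually_periodic (f : V -> V) :
  exists m, exists2 k, (0 < k)%N & forall v, iter (m + k) f v = iter m f v.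
Proof.
pose F (n : nat) : {ffun V -> V} := [ffun v => iter n f v].
have [a [b [ab Fab]]] : exists a b, (a < b)%N /\ F a = F b.
  pose G (n : 'I_(#|{ffun V -> V}|).+1) := F n.
  have /injectivePn[a [b ab Gab]] : ~~ injectiveb G.
    apply/negP => /injectiveP/leq_card; rewrite card_ord.
    by rewrite ltnn.
  have [lt|lt|eqab] := ltngtP a b.
  - by exists a, b.
  - by exists b, a.
  - by move: ab; rewrite -val_eqE /= eqab eqxx.
exists a, (b - a)%N; first by rewrite subn_gt0.
move=> v; rewrite subnKC ?(ltnW ab)//.
by have /ffunP/(_ v) := Fab; rewrite !ffunE.
Qed.

Lemma walks_eventually_periodic x : walks x -> exists J, exists2 k,
  (0 < k)%N & forall j, (J <= j)%R -> x (j + Posz k)%R = x j.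
Proof.
move=> [_ xP].
have [[J Js]|nJ] := pselect (exists J, forall j, (J <= j)%R -> x (j + 1)%R = s (x j)).
  have [m [k k0 mk]] := iter_eventually_periodic s.
  have xs n : x (J + Posz n)%R = iter n s (x J).
    elim: n => [|n IH]; first by rewrite addr0.
    by rewrite -addn1 PoszD addrA Js ?IH ?addn1// lerDl.
  exists (J + Posz m)%R, k => // j jJ.
  have [n ->] : exists n, j = (J + Posz m + Posz n)%R.
    by exists (absz (j - J - Posz m)%R); lia.
  by rewrite -!addrA -!PoszD !xs addnCA addnC iterD [RHS]iterD mk.
(* Now steps not given by [s] occur arbitrarily far to the right, so every backward step follows
   [p]. *)
have [m [k k0 mk]] := iter_eventually_periodic p.
have xp j : x (j - 1)%R = p (x j).
  have [j' jj' nj'] : exists2 j', (j < j')%R & x (j' + 1)%R <> s (x j').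
    apply: contrapT => nj; apply: nJ; exists (j + 1)%R => j' jj'.
    by apply: contrapT => nj'; apply: nj; exists j' => //; rewrite -lezD1.
  by case: (xP _ _ jj').
have xpn n j : x (j - Posz n)%R = iter n p (x j).
  elim: n => [|n IH]; first by rewrite subr0.
  by rewrite -addn1 PoszD opprD addrA xp IH addn1.
exists 0%R, k => // j _.
(* Positions [j + k] and [j] lie [m] and [m + k] backward steps from [j + k + m]. *)
have := xpn m (j + Posz k + Posz m)%R; rewrite addrK => ->.
by rewrite -mk -xpn addnC PoszD opprD addrA addrAC addrK addrK.
Qed.

Lemma eventually_periodic_limit (x : W) J k : (0 < k)%N ->
  (forall j, (J <= j)%R -> x (j + Posz k)%R = x j) ->
  exists q : W, biseq_shift k q = q /\
    (fun n : nat => biseq_shift (Posz (n * k)) x) @ \oo --> q.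
Proof.
move=> k0 xk.
have xnk j n : (J <= j)%R -> x (j + Posz (n * k))%R = x j.
  move=> Jj; elim: n => [|n IH]; first by rewrite mul0n addr0.
  rewrite mulSn addnC PoszD addrA xk//.
  by apply: le_trans Jj _; rewrite lerDl.
(* As [k] is positive, [M j] steps of length [k] bring [j] past [J], where the value no longer
   changes along multiples of [k]. *)
pose M (j : int) : nat := absz (J - j)%R.
have JM j n : (M j <= n)%N -> (J <= j + Posz (n * k))%R.
  by rewrite /M; nia.
pose q : W := fun j => x (j + Posz (M j * k))%R.
have qE j n : (M j <= n)%N -> x (j + Posz (n * k))%R = q j.
  by move=> Mn; rewrite -(subnKC Mn) mulnDl PoszD addrA xnk//; exact: JM.
exists q; split.
  apply/funext => j; rewrite /biseq_shift.
  rewrite -(qE j (M j + M (j + k)%R).+1); last by rewrite leqW// leq_addr.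
  rewrite -(qE (j + k)%R (M j + M (j + k)%R)%N) ?leq_addl//.
  by rewrite mulSn PoszD addrA.
apply: cvg_coord => j; exists (M j) => // n /= Mn.
exact: qE.
Qed.

End walks.

(** * Homeomorphisms respecting labels *)

Lemma zero_dimensional_prod (X Y : topologicalType) :
  zero_dimensional X -> zero_dimensional Y -> zero_dimensional (X * Y)%type.
Proof.
move=> zX zY [x y] [x' y']; rewrite xpair_eqE negb_and => /orP[/zX|/zY].
  move=> [U [clU Ux nUx']]; exists (fst @^-1` U); split => //.
  by apply: preimage_clopen => // z; exact: cvg_fst.
move=> [U [clU Uy nUy']]; exists (snd @^-1` U); split => //.
by apply: preimage_clopen => // z; exact: cvg_snd.
Qed.

(** The approximating points move only in the perfect factor [Y]; this is why the model carries a
    Cantor factor, whatever isolated points the walks have. *)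
Lemma setX_limit_point (X Y : topologicalType) (A : set X) :
  perfect_set [set: Y] -> A `*` [set: Y] `<=` limit_point (A `*` [set: Y]).
Proof.
move=> [_ pY] [x y] [/= Ax _] U [[B C] [/= nB nC] BCU].
have : limit_point [set: Y] y by rewrite pY.
move=> /(_ _ nC)[y' [y'y _ Cy']]; exists (x, y'); split => //.
  by apply: contra y'y => /eqP[->].
by apply: BCU; split => //=; exact: nbhs_singleton.
Qed.

Definition locally_constant (X : topologicalType) I (a : X -> I) :=
  forall x, \forall z \near x, a z = a x.

(** One half of a homeomorphism between [A] and [B]; the other half exchanges the roles of [h] and
    [k]. *)
Definition embeds_via (X Y : topologicalType) (A : set X) (B : set Y)
    (h : X -> Y) (k : Y -> X) :=
  [/\ {homo h : x / A x >-> B x}, {in A, cancel h k} &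
      {within A, continuous h}].

Section labelled_homeomorphism.
Context (R : realType) (I : Type).

Definition labelled (X : Type) (A : set X) (a : X -> I) i :=
  A `&` [set x | a x = i].

(** Each nonempty label class is relatively clopen in [A], hence compact without isolated points.
    Empty classes receive arbitrary constant maps. *)
Lemma labelled_parametrization (X : pseudoMetricType R) (A : set X) (a : X -> I) :
  zero_dimensional X -> compact A -> A `<=` limit_point A -> A !=set0 ->
  locally_constant a ->
  exists gf : I -> (cantor_space -> X) * (X -> cantor_space),
    forall i, labelled A a i !=set0 ->
      parametrizes (labelled A a i) (gf i).1 (gf i).2.
Proof.
move=> zX cA lA [x0 _] la.
suff H i : exists gf : (cantor_space -> X) * (X -> cantor_space),
    labelled A a i !=set0 -> parametrizes (labelled A a i) gf.1 gf.2.
  by have [gf gfP] := choice H; exists gf.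
have [Ai0|] := pselect (labelled A a i !=set0); last by exists (cst x0, cst point).
have [||//|g [f gf]] := @cantor_subset_parametrization R X (labelled A a i) zX.
- apply: compact_closedI => // x xcl.
  by have [z [<- ->]] := xcl _ (la x).
- move=> x [Ax aix] U nU.
  have [y [yx Ay [Uy ay]]] := lA x Ax _ (filterI nU (la x)).
  by exists y; split => //; split => //; rewrite /= ay.
- by exists (g, f).
Qed.

(** Each class is sent through the Cantor space to the class with the same label; near a point the
    label is constant, so a single piece of [h] decides continuity. *)
Lemma labelled_glue (X Y : pseudoMetricType R) (A : set X) (B : set Y)
    (a : X -> I) (b : Y -> I) gA gB :
  locally_constant a ->
  (forall i, labelled A a i !=set0 ->
     @parametrizes cantor_space _ (labelled A a i) (gA i).1 (gA i).2) ->
  (forall i, labelled B b i !=set0 ->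
     @parametrizes cantor_space _ (labelled B b i) (gB i).1 (gB i).2) ->
  (forall i, labelled A a i !=set0 -> labelled B b i !=set0) ->
  let h x := (gB (a x)).1 ((gA (a x)).2 x) in
  let k y := (gA (b y)).1 ((gB (b y)).2 y) in
  embeds_via A B h k /\ (forall x, A x -> b (h x) = a x).
Proof.
move=> la pA pB AB h k.
have ne x : A x -> labelled A a (a x) !=set0 by exists x.
have hB x : A x -> B (h x) /\ b (h x) = a x.
  by move=> Ax; have [_ + _ _ _] := pB _ (AB _ (ne _ Ax)); exact.
split; last by move=> x /hB[].
split.
- by move=> x /hB[].
- move=> x /set_mem Ax; rewrite /k (hB x Ax).2 /h.
  have [_ _ -> _ _] := pB _ (AB _ (ne _ Ax)).
  have [_ _ _ gfA _] := pA _ (ne _ Ax); apply: gfA.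
  by apply/mem_set; split.
- apply/subspace_continuousP => x Ax U nU.
  have [cg _ _ _ _] := pB _ (AB _ (ne _ Ax)).
  have [_ _ _ _ /subspace_continuousP cf] := pA _ (ne _ Ax).
  have := cf x (conj Ax erefl) _ (cg ((gA (a x)).2 x) U nU).
  move: (la x); apply: filterS2 => z az zP Az.
  have : U ((gB (a x)).1 ((gA (a x)).2 z)) by apply: zP; split.
  by rewrite -az.
Qed.

Lemma cantor_labelled_homeomorphism (X Y : pseudoMetricType R)
    (A : set X) (B : set Y) (a : X -> I) (b : Y -> I) :
  zero_dimensional X -> zero_dimensional Y ->
  compact A -> compact B -> A `<=` limit_point A -> B `<=` limit_point B ->
  A !=set0 -> locally_constant a -> locally_constant b ->
  (forall i, labelled A a i !=set0 <-> labelled B b i !=set0) ->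
  exists h k, [/\ embeds_via A B h k, embeds_via B A k h &
    forall x, A x -> b (h x) = a x].
Proof.
move=> zX zY cA cB lA lB A0 la lb AB.
have B0 : B !=set0.
  have [x Ax] := A0.
  by have /AB[y [By _]] : labelled A a (a x) !=set0; [exists x|exists y].
have [gA pA] := labelled_parametrization zX cA lA A0 la.
have [gB pB] := labelled_parametrization zY cB lB B0 lb.
have [hAB ab] := labelled_glue la pA pB (fun i => (AB i).1).
have [hBA _] := labelled_glue lb pB pA (fun i => (AB i).2).
by eexists; eexists; split; [exact: hAB|exact: hBA|exact: ab].
Qed.

End labelled_homeomorphism.

(** * The model system *)

Section model.
Context (V : finType) (E : V -> V -> Prop) (s p : V -> V).
Hypotheses (Es : forall v, E v (s v)) (Ep : forall v, E (p v) v).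

Definition model : set (biseq V * cantor_space) :=
  walks E s p `*` [set: cantor_space].

Definition model_shift (n : int) (y : biseq V * cantor_space) :
  biseq V * cantor_space := (biseq_shift n y.1, y.2).

Definition model_edge (y : biseq V * cantor_space) : V * V :=
  (y.1 0%R, y.1 1%R).

Lemma model_shift_continuous n : continuous (model_shift n).
Proof.
move=> y; apply: (@cvg_pair _ _ _ (nbhs y) (nbhs (biseq_shift n y.1)) (nbhs y.2) _ _ _
  (fun y => biseq_shift n y.1) snd); last exact: cvg_snd.
apply: (@cvg_comp _ _ _ fst (biseq_shift n) (nbhs y) (nbhs y.1)).
  exact: cvg_fst.
exact: biseq_shift_continuous.
Qed.

Lemma model_shiftD m n y : model_shift m (model_shift n y) = model_shift (m + n) y.
Proof. by congr pair; apply/funext => j; rewrite /biseq_shift addrA. Qed.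

Lemma model_shift0 y : model_shift 0 y = y.
Proof.
case: y => x c; congr pair; apply/funext => j.
by rewrite /biseq_shift addr0.
Qed.

Lemma iter_model_shift n y : iter n (model_shift 1) y = model_shift n y.
Proof.
elim: n => [|n IH]; first by rewrite model_shift0.
by rewrite iterS IH model_shiftD -PoszD add1n.
Qed.

Lemma model_shift_model n y : model y -> model (model_shift n y).
Proof. by move=> [yw _]; split => //; exact: shift_walks. Qed.

Lemma zero_dimensional_model_space :
  zero_dimensional (biseq V * cantor_space)%type.
Proof.
apply: zero_dimensional_prod; first exact: zero_dimensional_biseq.
exact: cantor_zero_dimensional.
Qed.

Lemma compact_model : compact model.
Proof.
apply: compact_setX; last exact: cantor_space_compact.
apply: (subclosed_compact _ (@compact_biseq V)) => //.
exact: closed_walks.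
Qed.

Lemma model_limit_point : model `<=` limit_point model.
Proof. by apply: setX_limit_point; exact: cantor_perfect. Qed.

Lemma locally_constant_model_edge : locally_constant model_edge.
Proof.
move=> y; have n0 := near_coord y.1 0%R; have n1 := near_coord y.1 1%R.
exists ([set z | z 0%R = y.1 0%R] `&` [set z | z 1%R = y.1 1%R], setT).
  by split; [exact: filterI|exact: filterT].
by move=> [z c] [[/= z0 z1] _]; rewrite /model_edge/= z0 z1.
Qed.

Lemma model_edgeP e : labelled model model_edge e !=set0 <-> E e.1 e.2.
Proof.
split=> [[y [[[yE _] _] <-]]|]; first exact: (yE 0%R).
move: e => [i j] /(walks_through_edge Es Ep)[x xw [x0 x1]].
by exists (x, point); split => //; rewrite /model_edge/= x0 x1.
Qed.

Lemma model_cvg_periodic y : model y -> exists q k,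
  [/\ model q, (0 < k)%N, iter k (model_shift 1) q = q &
      (fun n => iter (n * k) (model_shift 1) y) @ \oo --> q].
Proof.
move=> [yw _]; have [J [k k0 yk]] := walks_eventually_periodic yw.
have [q [kq yq]] := eventually_periodic_limit k0 yk.
exists (q, y.2), k; split => //.
(* The limit is a walk because shifts of [y.1] are walks and the walks are closed. *)
- split => //=; apply: (@closed_walks V E s p) => B /yq[n _ nB].
  exists (biseq_shift (Posz (n * k)) y.1); split; first exact: shift_walks.
  by apply: nB => /=.
- by rewrite iter_model_shift /model_shift /= kq.
- under eq_fun do rewrite iter_model_shift.
  apply: (@cvg_pair _ _ _ \oo (nbhs q) (nbhs y.2) _ _ _
    (fun n => biseq_shift (Posz (n * k)) y.1) (fun=> y.2)) => //.
  exact: cvg_cst.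
Qed.

End model.

(** * Conjugating a self-map of an invariant subset *)

Section conjugate.
Context (X Y : topologicalType) (M : set Y) (h : X -> Y) (k : Y -> X).
Hypotheses (hM : forall x, M (h x)) (hK : cancel h k) (ch : continuous h).
Hypotheses (kK : {in M, cancel k h}) (ck : {within M, continuous k}).

Let ckM y U : M y -> nbhs (k y) U -> \forall z \near y, M z -> U (k z).
Proof. by move=> My nU; move/subspace_continuousP : ck => /(_ y My); exact. Qed.

Lemma conjugate_continuous (S : Y -> Y) : (forall y, M y -> M (S y)) ->
  continuous S -> continuous (k \o S \o h).
Proof.
move=> MS cS x U nU; have := ckM (MS _ (hM x)) nU.
move=> /(cS (h x))/(@ch x) nz.
have : \forall z \near x, M (S (h z)) -> U (k (S (h z))) by [].
by apply: filterS => z; apply; exact/MS/hM.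
Qed.

Lemma conjugate_cancel (S S' : Y -> Y) : (forall y, M y -> M (S y)) ->
  cancel S S' -> cancel (k \o S \o h) (k \o S' \o h).
Proof. by move=> MS SK x /=; rewrite kK ?SK ?hK//; exact/mem_set/MS/hM. Qed.

Lemma iter_conjugate (S : Y -> Y) n x : (forall y, M y -> M (S y)) ->
  iter n (k \o S \o h) x = k (iter n S (h x)).
Proof.
move=> MS; elim: n => [|n IH]; first by rewrite /= hK.
rewrite !iterS IH /= kK//; apply/mem_set.
by elim: n {IH} => [|n IH]; [exact: hM|exact: MS].
Qed.

Lemma conjugate_cvg (u : nat -> Y) y : (forall n, M (u n)) -> M y ->
  u @ \oo --> y -> k \o u @ \oo --> k y.
Proof.
move=> Mu My uy U nU; have := ckM My nU.
move=> /uy nz; have : \forall n \near \oo, M (u n) -> U (k (u n)) by [].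
by apply: filterS => n; exact.
Qed.

End conjugate.

(** * Labelling points by the pieces of a finite closed partition *)

Section partition_labels.
Context (K : topologicalType) (N : nat) (Ks : 'I_N -> set K).
Hypotheses (cKs : forall i, closed (Ks i))
  (disjKs : forall i j, i != j -> Ks i `&` Ks j = set0)
  (covKs : \bigcup_i Ks i = [set: K]).

(** The pieces not containing [x] have a closed union, being finitely many, so all points near [x]
    share its piece. *)
Lemma partition_label : exists2 l : K -> 'I_N,
  (forall x i, Ks i x <-> l x = i) & locally_constant l.
Proof.
have ex x : exists i, Ks i x.
  by have : [set: K] x by []; rewrite -covKs => -[i _ ?]; exists i.
have [l lP] := choice ex.
have lE x i : Ks i x <-> l x = i.
  split=> [Kx|<-//]; apply: contrapT => /eqP ne.
  by have : (Ks (l x) `&` Ks i) x by []; rewrite disjKs.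
exists l => // x.
have cl : closed (\bigcup_(i in [set i | i <> l x]) Ks i).
  by apply: closed_bigcup => //; exact: finite_finset.
have : nbhs x (~` \bigcup_(i in [set i | i <> l x]) Ks i).
  apply: open_nbhs_nbhs; split; first exact: closed_openC.
  by move=> [i /= il /lE li]; apply: il.
apply: filterS => z nz; apply: contrapT => zx.
by apply: nz; exists (l z).
Qed.

End partition_labels.

(** * Transport of the model shift to [K] *)

Theorem theorem4p1 (R : realType) (K : metricType R) (T : K -> K)
    (N : nat) (Ks : 'I_N -> set K) :
  is_cantor_set [set: K] ->
  homeomorphism T ->
  (forall i, is_cantor_set (Ks i)) ->
  (forall i j, i != j -> Ks i `&` Ks j = set0) ->
  \bigcup_i Ks i = [set: K] ->
  exists Tt : K -> K,
    [/\ homeomorphism Tt,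
        (forall (x : K) (i : 'I_N), Ks i (Tt x) <-> Ks i (T x)) &
        (forall x : K, periodic_orbit Tt (omega_limit Tt x))].
Proof.
move=> [K0 cK [_ pK] tdK] [T' [TK T'K cT _]] cantorKs disjKs covKs.
have hK : hausdorff_space K by exact: metric_hausdorff.
have zK := totally_disconnected_zero_dimensional hK cK tdK.
have cKs i : closed (Ks i) by have [_ _ []] := cantorKs i.
have [l lE ll] := partition_label cKs disjKs covKs.
have exK i : exists x, l x = i.
  by have [[x /lE Kx] _ _ _] := cantorKs i; exists x.
(* The image and the preimage under [T] of the chosen point [pt i] supply a successor and a
   predecessor of [i]. *)
have [pt ptl] := choice exK.
pose a x := (l x, l (T x)).
pose E i j := exists x, a x = (i, j).
pose s i := l (T (pt i)).
pose p i := l (T' (pt i)).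
have Es i : E i (s i) by exists (pt i); rewrite /a ptl.
have Ep i : E (p i) i by exists (T' (pt i)); rewrite /a T'K ptl.
have la : locally_constant a.
  move=> x; have := cT x _ (ll (T x)).
  by move: (ll x); apply: filterS2 => z /= lz lTz; rewrite /a lz lTz.
pose M := model E s p.
have [||h [k [[hM hK' chT] [_ kK ck] ba]]] :=
  @cantor_labelled_homeomorphism R _ K _ setT M a (@model_edge _)
    zK (@zero_dimensional_model_space _) cK (@compact_model _ E s p) _
    (@model_limit_point _ E s p) K0 la (@locally_constant_model_edge _).
- by rewrite pK.
- move=> e; rewrite (model_edgeP Es Ep); split=> [[x [_ <-]]|[x xe]].
    by exists x.
  by exists x; split => //; rewrite /= xe -surjective_pairing.
have ch : continuous h by apply/continuous_subspace_setT.
have hMT x : M (h x) by exact: hM.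
have hKT : cancel h k by move=> x; exact/hK'/in_setT.
pose S := model_shift (V := 'I_N) 1.
pose S' := model_shift (V := 'I_N) (-1).
have MS y : M y -> M (S y) by exact: model_shift_model.
have MS' y : M y -> M (S' y) by exact: model_shift_model.
have SK : cancel S S' by move=> y; rewrite /S /S' model_shiftD addNr model_shift0.
have S'K : cancel S' S by move=> y; rewrite /S /S' model_shiftD addrN model_shift0.
have cS n := @model_shift_continuous 'I_N n.
have cTt : continuous (k \o S \o h).
  exact: (conjugate_continuous hMT ch ck MS (cS 1%R)).
exists (k \o S \o h); split.
- exists (k \o S' \o h); split => //.
  + exact: (conjugate_cancel hMT).
  + exact: (conjugate_cancel hMT).
  + exact: (conjugate_continuous hMT ch ck MS' (cS (-1)%R)).
- move=> x i; suff lTt : l ((k \o S \o h) x) = l (T x).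
    by split => /lE xi; apply/lE; rewrite -xi lTt.
  (* The edge crossed by the shifted walk starts where the edge crossed by [h x] ends, namely at
     [l (T x)]. *)
  have /(congr1 fst) /= <- := ba ((k \o S \o h) x) I.
  have /(congr1 snd) /= <- := ba x I.
  by rewrite /= kK//; exact/mem_set/MS.
- move=> x; have [q [m [Mq m0 mq xq]]] := model_cvg_periodic (hMT x).
  have Mn n : M (iter n S (h x)) by elim: n => //= n; exact: MS.
  apply: (@omega_limit_periodic _ _ _ (k q) m) => //.
    by rewrite (iter_conjugate hMT)// kK ?mq//; exact: mem_set.
  under eq_fun do rewrite (iter_conjugate hMT)//.
  exact: (conjugate_cvg ck _ Mq xq).
Qed.
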